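(* Let $(A,q)$ be a finite metric abelian group and $n\ge2$. (1) For every $Q\in\mathcal Q^-(q)$, with $R=|A|^{-1/2}\sum_{a\in A}Q(a)X_a\otimes Z_a$, the image $\rho_{R,n}(\mathcal B_n)$ is finite. (2) Let $E\in\mathrm{Aut}(A)$ satisfy $\langle Ex,y\rangle=\langle x,Ey\rangle$ for all $x,y\in A$, and let $Q_E,P_E:A\to\mathrm U(1)$ satisfy $Q_E(x+y)=Q_E(x)Q_E(y)\langle Ex,y\rangle$ and $P_E(x+y)=P_E(x)P_E(y)\langle E^{-1}x,y\rangle$ for all $x,y\in A$. With $$R=\overline{\gamma(P_E)}\,|A|^{-1}\sum_{t,c\in A}Q_E(t)P_E(c)(X_tZ_c)\otimes(X_{-t}Z_c),$$ the image $\rho_{R,n}(\mathcal B_n)$ is finite.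
   Context: $\mathrm U(1)$ denotes the complex numbers of modulus one. A finite metric abelian group $(A,q)$ is a finite abelian group $A$ (written additively) with $q:A\to\mathrm U(1)$ such that $q(-a)=q(a)$ and $\langle a,b\rangle:=\frac{q(a+b)}{q(a)q(b)}$ is a nondegenerate symmetric bicharacter on $A$. $\mathcal Q^-(q)=\{q^{-1}\chi:\chi\in\mathrm{Hom}(A,\mathrm U(1))\}$ and $\gamma(F)=|A|^{-1/2}\sum_{a\in A}F(a)$. $V=\mathbb C[A]$ is the Hilbert space with orthonormal basis $\{e_x:x\in A\}$, $X_ae_x=e_{x+a}$, $Z_ae_x=\langle a,x\rangle e_x$; the operators $R$ act on $V\otimes V$ and are unitary Yang--Baxter operators. $\mathcal B_n$ is the braid group on $n$ strands with Artin generators $\sigma_i$; $\rho_{R,n}:\mathcal B_n\to\mathrm U(V^{\otimes n})$ is $\rho_{R,n}(\sigma_i)=I^{\otimes(i-1)}\otimes R\otimes I^{\otimes(n-i-1)}$. *)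

(* Defs.v *)
From HB Require Import structures.
From mathcomp Require Import all_boot all_order all_algebra sesquilinear spectral.
From mathcomp Require Import mxtens complex.
From mathcomp Require Import boolp classical_sets cardinality reals.

Set Implicit Arguments.
Unset Strict Implicit.
Unset Printing Implicit Defensive.

Import Order.TTheory GRing.Theory Num.Theory.
Local Open Scope ring_scope.
Local Open Scope quotient_scope.

Section MetricGroup.
Variables (C : numClosedFieldType) (A : finZmodType).
Implicit Types (q f chi : A -> C) (b : A -> A -> C).

Definition U1_valued f := forall a, `|f a| = 1.

Definition U1_character chi :=
  U1_valued chi /\ {morph chi : x y / x + y >-> x * y}.

Definition symmetric_bicharacter b :=
  [/\ forall x, U1_character (b x),
      forall y, U1_character (b^~ y)
    & forall x y, b x y = b y x].

Definition nondegenerate b := forall x, (forall y, b x y = 1) -> x = 0.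

Definition pairing q (x y : A) : C := q (x + y) / (q x * q y).

Definition metric_group q :=
  [/\ U1_valued q,
      forall a, q (- a) = q a,
      symmetric_bicharacter (pairing q)
    & nondegenerate (pairing q)].

Definition Qminus q : set (A -> C) :=
  [set Q | exists2 chi, U1_character chi & forall a, Q a = (q a)^-1 * chi a].

Definition sqrt_card : C := sqrtC #|A|%:R.

Definition gauss_sum f : C := sqrt_card^-1 * \sum_a f a.

(* Operators on V = C[A] are matrices acting on column vectors, in the basis
   e_x listed by [enum A]. *)
Definition shift_mx (a : A) : 'M[C]_#|A| :=
  \matrix_(i, j) (enum_val i == enum_val j + a)%:R.

Definition phase_mx q (a : A) : 'M[C]_#|A| :=
  diag_mx (\row_j pairing q a (enum_val j)).

(* Operators on V (x) V; [*t] is the Kronecker product of matrices. *)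
Definition R_gaussian q (Q : A -> C) : 'M[C]_(#|A| * #|A|) :=
  sqrt_card^-1 *: \sum_(a : A) Q a *: (shift_mx a *t phase_mx q a).

Definition R_automorphism q (QE PE : A -> C) : 'M[C]_(#|A| * #|A|) :=
  ((gauss_sum PE)^* / #|A|%:R) *:
    \sum_(t : A) \sum_(c : A) (QE t * PE c) *:
      ((shift_mx t *m phase_mx q c) *t (shift_mx (- t) *m phase_mx q c)).

End MetricGroup.

(* The letter [(i, false)] stands for the Artin generator number [i] (counted
   from 0), and [(i, true)] for its inverse. *)
Definition braid_word n := seq ('I_n.-1 * bool).

Inductive braid_eqv n : braid_word n -> braid_word n -> Prop :=
| braid_refl u : braid_eqv u u
| braid_sym u v : braid_eqv u v -> braid_eqv v u
| braid_trans u v w : braid_eqv u v -> braid_eqv v w -> braid_eqv u w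
| braid_cat u u' v v' :
    braid_eqv u u' -> braid_eqv v v' -> braid_eqv (u ++ v) (u' ++ v')
| braid_cancel i b : braid_eqv [:: (i, b); (i, ~~ b)] [::]
| braid_far (i j : 'I_n.-1) : (i.+1 < j)%N ->
    braid_eqv [:: (i, false); (j, false)] [:: (j, false); (i, false)]
| braid_near (i j : 'I_n.-1) : j = i.+1 :> nat ->
    braid_eqv [:: (i, false); (j, false); (i, false)]
              [:: (j, false); (i, false); (j, false)].

Section BraidGroup.
Variable n : nat.

Definition braid_eqvb (u v : braid_word n) : bool := `[< braid_eqv u v >].

Lemma braid_eqvb_refl : reflexive braid_eqvb.
Proof. by move=> u; apply/asboolP; apply: braid_refl. Qed.

Lemma braid_eqvb_sym : symmetric braid_eqvb.
Proof.
by move=> u v; apply/asboolP/asboolP; apply: braid_sym.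
Qed.

Lemma braid_eqvb_trans : transitive braid_eqvb.
Proof.
by move=> v u w /asboolP uv /asboolP vw; apply/asboolP; apply: braid_trans vw.
Qed.

Canonical braid_equiv :=
  EquivRel braid_eqvb braid_eqvb_refl braid_eqvb_sym braid_eqvb_trans.

Definition braid_group := {eq_quot braid_equiv}.

HB.instance Definition _ := Choice.on braid_group.
HB.instance Definition _ := EqQuotient.on braid_group.

Definition braid_of (u : braid_word n) : braid_group := \pi_braid_group u.

Lemma braid_ofP u v : braid_eqv u v <-> braid_of u = braid_of v.
Proof.
split=> [uv|/eqmodP/asboolP //].
by apply/eqmodP/asboolP.
Qed.

Lemma braid_of_repr (x : braid_group) : braid_of (repr x) = x.
Proof. exact: reprK. Qed.

Definition braid_winv (u : braid_word n) : braid_word n :=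
  rev [seq (x.1, ~~ x.2) | x <- u].

Definition braid_one : braid_group := braid_of [::].
Definition braid_mul (x y : braid_group) := braid_of (repr x ++ repr y).
Definition braid_inv (x : braid_group) := braid_of (braid_winv (repr x)).

Lemma braid_mulE u v : braid_mul (braid_of u) (braid_of v) = braid_of (u ++ v).
Proof. by apply/braid_ofP; apply: braid_cat; apply/braid_ofP/braid_of_repr. Qed.

Lemma braid_winvl u : braid_eqv (braid_winv u ++ u) [::].
Proof.
elim: u => [|[i b] u IHu]; first exact: braid_refl.
rewrite /braid_winv /= rev_cons -cats1 -catA.
apply: (braid_trans _ IHu); apply: braid_cat; first exact: braid_refl.
apply: (@braid_cat _ [:: (i, ~~ b); (i, b)] [::] u u); last exact: braid_refl.
by have := braid_cancel i (~~ b); rewrite negbK.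
Qed.

Lemma braid_winvr u : braid_eqv (u ++ braid_winv u) [::].
Proof.
have winvK : braid_winv (braid_winv u) = u.
  rewrite /braid_winv map_rev revK -map_comp -[RHS]map_id.
  by apply: eq_map => -[i b] /=; rewrite negbK.
by rewrite -{1}winvK; apply: braid_winvl.
Qed.

Lemma braid_mulA : associative braid_mul.
Proof.
move=> x y z; rewrite -(braid_of_repr x) -(braid_of_repr y) -(braid_of_repr z).
by rewrite !braid_mulE catA.
Qed.

Lemma braid_mul1 : left_id braid_one braid_mul.
Proof. by move=> x; rewrite -(braid_of_repr x) braid_mulE. Qed.

Lemma braid_mulr1 : right_id braid_one braid_mul.
Proof. by move=> x; rewrite -(braid_of_repr x) braid_mulE cats0. Qed.

Lemma braid_mulV : left_inverse braid_one braid_inv braid_mul.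
Proof.
move=> x; rewrite -{2}(braid_of_repr x) braid_mulE.
exact/braid_ofP/braid_winvl.
Qed.

Lemma braid_mulrV : right_inverse braid_one braid_inv braid_mul.
Proof.
move=> x; rewrite -{1}(braid_of_repr x) braid_mulE.
exact/braid_ofP/braid_winvr.
Qed.

HB.instance Definition _ := isGroup.Build braid_group
  braid_mulA braid_mul1 braid_mulr1 braid_mulV braid_mulrV.

Definition braid_gen (i : 'I_n.-1) : braid_group := braid_of [:: (i, false)].

End BraidGroup.

Section UnitaryGroup.
Local Open Scope sesquilinear_scope.
Variables (C : numClosedFieldType) (m : nat).

Record unitary_group := UnitaryMx {
  unitary_val :> 'M[C]_m;
  unitary_valP : unitary_val \is unitarymx }.

HB.instance Definition _ := [isSub for unitary_val].
HB.instance Definition _ := [Choice of unitary_group by <:].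

Lemma unitarymx_adj (M : 'M[C]_m) : M \is unitarymx -> M^t* *m M = 1%:M.
Proof. by move/unitarymxP/mulmx1C. Qed.

Lemma unitarymx_one : (1%:M : 'M[C]_m) \is unitarymx.
Proof. by apply/unitarymxP; rewrite mul1mx trmx1 map_mx1. Qed.

Lemma unitarymx_inv (M : 'M[C]_m) : M \is unitarymx -> M^t* \is unitarymx.
Proof. by rewrite trmxC_unitary. Qed.

Definition unitary_one := UnitaryMx unitarymx_one.
Definition unitary_mul (M N : unitary_group) :=
  UnitaryMx (mul_unitarymx (unitary_valP M) (unitary_valP N)).
Definition unitary_inv (M : unitary_group) :=
  UnitaryMx (unitarymx_inv (unitary_valP M)).

Lemma unitary_mulA : associative unitary_mul.
Proof. by move=> M N P; apply: val_inj; rewrite /= mulmxA. Qed.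

Lemma unitary_mul1 : left_id unitary_one unitary_mul.
Proof. by move=> M; apply: val_inj; rewrite /= mul1mx. Qed.

Lemma unitary_mulr1 : right_id unitary_one unitary_mul.
Proof. by move=> M; apply: val_inj; rewrite /= mulmx1. Qed.

Lemma unitary_mulV : left_inverse unitary_one unitary_inv unitary_mul.
Proof.
by move=> M; apply: val_inj; rewrite /= unitarymx_adj ?unitary_valP.
Qed.

Lemma unitary_mulrV : right_inverse unitary_one unitary_inv unitary_mul.
Proof.
by move=> M; apply: val_inj; apply/unitarymxP; apply: unitary_valP.
Qed.

HB.instance Definition _ := isGroup.Build unitary_group
  unitary_mulA unitary_mul1 unitary_mulr1 unitary_mulV unitary_mulrV.

End UnitaryGroup.

(* Strand [i] is counted from 0, so [i] tensor factors precede [R] and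
   [n - i.+2] follow it. *)
Lemma braid_dim (d n : nat) (i : 'I_n.-1) :
  (d ^ i * (d * d) * d ^ (n - i.+2) = d ^ n)%N.
Proof.
case: n i => [|[|n]] [i lti] //=.
by rewrite mulnn -!expnD !subSS addn2 !addSn subnKC // -ltnS.
Qed.

Section BraidRep.
Variables (C : numClosedFieldType) (d n : nat) (R : 'M[C]_(d * d)).

(* The Kronecker index maps list pairs lexicographically, hence are strictly
   associative: the cast is the canonical identification of
   V^i (x) (V (x) V) (x) V^(n-i-2) with V^n. *)
Definition local_op (i : 'I_n.-1) : 'M[C]_(d ^ n) :=
  castmx (braid_dim d i, braid_dim d i)
    ((1%:M : 'M[C]_(d ^ i)) *t R *t (1%:M : 'M[C]_(d ^ (n - i.+2)))).

(* [rho] is the representation attached to [R]; it is unique when it exists,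
   which is the case when [R] is a unitary Yang-Baxter operator. *)
Definition is_braid_rep
    (rho : {multiplicative braid_group n -> unitary_group C (d ^ n)}) :=
  forall i, unitary_val (rho (braid_gen i)) = local_op i.

Lemma is_braid_rep_uniq rho rho' :
  is_braid_rep rho -> is_braid_rep rho' -> rho =1 rho'.
Proof.
have mul1 (f : {multiplicative braid_group n -> unitary_group C (d ^ n)}) :
    f 1%g = 1%g.
  by apply: (mulgI (f 1%g)); rewrite -gmulfM !mulg1.
move=> rhoP rho'P x; rewrite -(braid_of_repr x).
elim: (repr x) => [|[i b] u IHu]; first by rewrite [LHS]mul1 [RHS]mul1.
have -> : braid_of ((i, b) :: u) = (braid_of [:: (i, b)] * braid_of u)%g.
  by rewrite [RHS]braid_mulE.
rewrite !gmulfM IHu; congr (_ * _)%g.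
have gen : rho (braid_gen i) = rho' (braid_gen i).
  by apply: val_inj; rewrite /= rhoP rho'P.
case: b => //; apply: (mulgI (rho (braid_gen i))).
rewrite [in RHS]gen -!gmulfM.
have -> : (braid_gen i * braid_of [:: (i, true)] = 1)%g.
  by rewrite [LHS]braid_mulE; apply/braid_ofP; apply: (braid_cancel i false).
by rewrite !mul1.
Qed.

End BraidRep.

(* Main.v *)
Require Import Defs.
From HB Require Import structures.
From mathcomp Require Import all_boot all_order all_fingroup all_algebra spectral.
From mathcomp Require Import mxtens complex ring zify.
From mathcomp Require Import boolp classical_sets cardinality reals.

Set Implicit Arguments.
Unset Strict Implicit.
Unset Printing Implicit Defensive.

Import Order.TTheory GRing.Theory Num.Theory.
Local Open Scope classical_set_scope.
Local Open Scope ring_scope.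
Local Open Scope sesquilinear_scope.

(** Both families of operators are built from Gaussian operators
    [|A|^(-1/2) sum_a Q(a) T_a], where [T] is a representation of [A] by Weyl
    (generalized Pauli) operators [X_u Z_w] on [V^n] and [Q] is a nondegenerate
    quadratic function.  Completing the square shows that conjugation by a
    Gaussian operator sends a Weyl operator to a root of unity times a Weyl
    operator; this yields the Yang-Baxter equation from the commutation relations
    alone and puts the image of the braid group inside a Clifford group.  A
    Clifford operator is determined up to a scalar by its action on the finitely
    many Weyl operators, since these have scalar commutant, and the scalar is
    confined to finitely many values once the determinant is a root of unity.
    The latter reduces to the Gauss sum of [Q] being a root of unity, which
    follows by taking determinants in [(D S)^3 = gamma], with [S] the Fourier
    matrix of [A] and [D] the diagonal matrix of [Q]. *)

(** * Bicharacters on a finite abelian group *)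

Lemma mulrn_card (A : finZmodType) (a : A) : a *+ #|A| = 0.
Proof.
apply: (addrI (\sum_(x : A) x)); rewrite addr0 -sumr_const -big_split /=.
by rewrite [RHS](reindex_inj (addIr a)).
Qed.

Section Bicharacter.
Variables (C : numClosedFieldType) (A : finZmodType) (b : A -> A -> C).
Hypothesis bP : symmetric_bicharacter b.

Lemma bicharC x y : b x y = b y x.
Proof. by case: bP. Qed.

Lemma bicharDl x y z : b (x + y) z = b x z * b y z.
Proof. by case: bP => _ /(_ z)[_ ->]. Qed.

Lemma bicharDr x y z : b x (y + z) = b x y * b x z.
Proof. by rewrite bicharC bicharDl !(bicharC _ x). Qed.

Lemma bichar_norm x y : `|b x y| = 1.
Proof. by case: bP => /(_ x)[->]. Qed.

Lemma bichar_neq0 x y : b x y != 0.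
Proof. by rewrite -normr_eq0 bichar_norm oner_eq0. Qed.

Lemma bichar0l x : b 0 x = 1.
Proof. by apply: (mulfI (bichar_neq0 0 x)); rewrite -bicharDl addr0 mulr1. Qed.

Lemma bichar0r x : b x 0 = 1.
Proof. by rewrite bicharC bichar0l. Qed.

Lemma bicharNl x y : b (- x) y = (b x y)^-1.
Proof.
apply: (mulfI (bichar_neq0 x y)).
by rewrite -bicharDl subrr bichar0l divff ?bichar_neq0.
Qed.

Lemma bicharNr x y : b x (- y) = (b x y)^-1.
Proof. by rewrite bicharC bicharNl bicharC. Qed.

Lemma bichar_conj x y : (b x y)^* = (b x y)^-1.
Proof. by rewrite invC_norm bichar_norm expr1n invr1 mul1r. Qed.

Lemma bichar_mulrn x y k : b (x *+ k) y = b x y ^+ k.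
Proof.
by elim: k => [|k IHk]; rewrite ?bichar0l // mulrS bicharDl IHk exprS.
Qed.

Lemma bichar_exp_card x y : b x y ^+ #|A| = 1.
Proof. by rewrite -bichar_mulrn mulrn_card bichar0l. Qed.

(** Orthogonality of characters: if [b x y != 1], translating the summation variable by [y]
    multiplies the sum by [b x y], so the sum vanishes. *)
Lemma sum_bichar : Defs.nondegenerate b ->
  forall x, \sum_y b x y = #|A|%:R * (x == 0)%:R.
Proof.
move=> b_nd x; have [->|x_neq0] := eqVneq x 0.
  by rewrite mulr1 (eq_bigr _ (fun y _ => bichar0l y)) /= sumr_const.
have [y bxy] : exists y, b x y != 1.
  apply: contra_neqP x_neq0 => /forallNP bx1; apply: b_nd => y.
  by apply/eqP; apply: contra_notT (bx1 y).
rewrite mulr0; apply: contraNeq bxy => S_neq0; apply/eqP.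
apply: (mulIf S_neq0); rewrite mul1r [RHS](reindex_inj (addrI y)) mulr_sumr /=.
by apply: eq_bigr => z _; rewrite bicharDr.
Qed.

End Bicharacter.

(** * Quadratic functions refining a bicharacter *)

(** [Q (- x)] and [Q x] may differ, so a character can be absorbed into [Q], as the members of
    [Qminus] demand. *)
Definition quadratic_for (C : numClosedFieldType) (A : finZmodType)
    (b : A -> A -> C) (Q : A -> C) :=
  U1_valued Q /\ forall x y, Q (x + y) = Q x * Q y * b x y.

Section Quadratic.
Variables (C : numClosedFieldType) (A : finZmodType) (b : A -> A -> C).
Variable Q : A -> C.
Hypotheses (bP : symmetric_bicharacter b) (QP : quadratic_for b Q).

Lemma quadD x y : Q (x + y) = Q x * Q y * b x y.
Proof. exact: QP.2. Qed.

Lemma quad_norm x : `|Q x| = 1.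
Proof. exact: QP.1. Qed.

Lemma quad_neq0 x : Q x != 0.
Proof. by rewrite -normr_eq0 quad_norm oner_eq0. Qed.

Lemma quad_conj x : (Q x)^* = (Q x)^-1.
Proof. by rewrite invC_norm quad_norm expr1n invr1 mul1r. Qed.

Lemma quad0 : Q 0 = 1.
Proof.
have := quadD 0 0; rewrite addr0 bichar0l // mulr1 => Q0.
by apply: (mulfI (quad_neq0 0)); rewrite -Q0 mulr1.
Qed.

Lemma quadN x : Q x * Q (- x) = b x x.
Proof.
apply: (mulIf (bichar_neq0 bP x (- x))); rewrite -quadD subrr quad0.
by rewrite bicharNr // divff ?bichar_neq0.
Qed.

Lemma quad_mulrn x k : Q (x *+ k) = Q x ^+ k * b x x ^+ 'C(k, 2).
Proof.
elim: k => [|k IHk]; first by rewrite mulr0n quad0 mulr1.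
rewrite mulrSr quadD IHk bichar_mulrn // binS bin1 exprD exprSr.
by rewrite -!mulrA; congr (_ * _); rewrite mulrCA.
Qed.

Lemma quad_exp_card x : Q x ^+ (#|A| * 2) = 1.
Proof.
have := quad_mulrn x #|A|.
(* ['C(#|A|, 2)] need not be a multiple of [#|A|], but its double is; hence the squaring. *)
rewrite mulrn_card quad0 => /(congr1 (fun z => z ^+ 2)).
rewrite /= expr1n exprMn -!exprM [('C(_, 2) * 2)%N]mulnC -mul_bin_diag.
by rewrite (exprM (b x x)) (bichar_exp_card bP) expr1n mulr1.
Qed.

End Quadratic.

(** * Twisting a bicharacter by a self-adjoint additive map *)

Section Twist.
Variables (C : numClosedFieldType) (A : finZmodType) (b : A -> A -> C).
Variable E : A -> A.
Hypotheses (bP : symmetric_bicharacter b) (b_nd : Defs.nondegenerate b).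
Hypothesis ED : {morph E : x y / x + y}.
Hypothesis E_adj : forall x y, b (E x) y = b x (E y).

Lemma twist_bichar : symmetric_bicharacter (fun x y => b (E x) y).
Proof.
split=> [x|y|x y]; last by rewrite E_adj (bicharC bP).
  by split=> [y|y z]; rewrite ?(bichar_norm bP) ?(bicharDr bP).
by split=> [x|x z]; rewrite ?(bichar_norm bP) ?ED ?(bicharDl bP).
Qed.

Lemma twist_nd : injective E -> Defs.nondegenerate (fun x y => b (E x) y).
Proof.
move=> E_inj x xP; apply: E_inj; rewrite (b_nd xP).
by apply: (addrI (E 0)); rewrite -ED !addr0.
Qed.

End Twist.

(** * Gauss sums are roots of unity *)

Section GaussSum.
Variables (C : numClosedFieldType) (A : finZmodType) (b : A -> A -> C).
Variable Q : A -> C.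
Hypotheses (bP : symmetric_bicharacter b) (b_nd : Defs.nondegenerate b).
Hypothesis QP : quadratic_for b Q.

Local Notation s := (sqrt_card C A).

Lemma card_neq0 : #|A|%:R != 0 :> C.
Proof. by rewrite pnatr_eq0 -lt0n; apply/card_gt0P; exists 0. Qed.

Lemma sqrt_cardV2 : s^-1 * s^-1 = #|A|%:R^-1.
Proof. by rewrite -expr2 exprVn sqrtCK. Qed.

Lemma sqrt_card_conj : (s^-1)^* = s^-1.
Proof.
by apply: conj_Creal; rewrite rpredV ger0_real // sqrtC_ge0 ler0n.
Qed.

(** Completing the square: [Q y * b x y = Q (x + y) / Q x]. *)
Lemma gauss_sum_shift x :
  s^-1 * \sum_y Q y * b x y = gauss_sum Q / Q x.
Proof.
rewrite /gauss_sum -mulrA mulr_suml; congr (_ * _).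
rewrite [RHS](reindex_inj (addrI x)) /=; apply: eq_bigr => y _.
by rewrite (quadD QP) (bicharC bP); field; exact: quad_neq0 QP x.
Qed.

Let ev := @enum_val A A.

Lemma sum_enum_val (F : A -> C) : \sum_j F (ev j) = \sum_x F x.
Proof.
by rewrite [RHS](reindex ev) //; apply: onW_bij; apply: enum_val_bij.
Qed.

(** [S] is the normalised Fourier matrix of [b] and [S'] its entrywise conjugate. *)
Let S : 'M[C]_#|A| := \matrix_(i, j) (s^-1 * b (ev i) (ev j)).
Let S' : 'M[C]_#|A| := \matrix_(i, j) (s^-1 * (b (ev i) (ev j))^-1).
Let D : 'M[C]_#|A| := diag_mx (\row_j Q (ev j)).

(** By orthogonality the square of the Fourier matrix is the permutation matrix of negation, an
    involution. *)
Let fourier_sqr : S *m S = \matrix_(i, j) (ev i + ev j == 0)%:R.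
Proof.
apply/matrixP => i k; rewrite !mxE.
under eq_bigr => j _.
  rewrite !mxE mulrACA (bicharC bP (ev j)) -(bicharDl bP) sqrt_cardV2; over.
rewrite -mulr_sumr (sum_enum_val (b _)) (sum_bichar bP b_nd).
by rewrite mulrA mulVf ?card_neq0 // mul1r.
Qed.

Let fourier_exp4 : S *m S *m (S *m S) = 1%:M.
Proof.
rewrite fourier_sqr; apply/matrixP => i k; rewrite !mxE.
under eq_bigr => j _ do rewrite !mxE.
rewrite (sum_enum_val (fun y => (ev i + y == 0)%:R * (y + ev k == 0)%:R)).
rewrite (bigD1 (- ev i)) //= subrr eqxx mul1r big1 ?addr0 => [|y].
  by rewrite addrC subr_eq0 eq_sym (inj_eq enum_val_inj).
by rewrite [ev i + y]addrC addr_eq0 => /negPf->; rewrite mul0r.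
Qed.

Let fourier_conj : S' *m S = 1%:M.
Proof.
apply/matrixP => i k; rewrite !mxE.
under eq_bigr => j _.
  rewrite !mxE mulrACA (bicharC bP (ev j)) -(bicharNl bP) -(bicharDl bP).
  rewrite sqrt_cardV2; over.
rewrite -mulr_sumr (sum_enum_val (b _)) (sum_bichar bP b_nd).
rewrite mulrA mulVf ?card_neq0 // mul1r addrC subr_eq0 eq_sym.
by rewrite (inj_eq enum_val_inj).
Qed.

(** At the entry of [x] and [z] the inner sum is a shifted Gauss sum, equal to
    [gauss_sum Q / Q (x + z)]; the outer factors [Q x * Q z] cancel its denominator up to
    [b x z]. *)
Let fourier_gauss : D *m S *m D *m S *m D = gauss_sum Q *: S'.
Proof.
apply/matrixP => i k.
rewrite mul_mx_diag -!mulmxA mul_diag_mx !mxE.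
under eq_bigr => j _.
  rewrite mul_diag_mx !mxE mulrCA mulrACA (bicharC bP (ev j)) mulrCA.
  rewrite -(bicharDl bP); over.
rewrite (sum_enum_val (fun y => s^-1 * s^-1 * (Q y * b (ev i + ev k) y))).
rewrite -mulr_sumr -[s^-1 / s * _]mulrA gauss_sum_shift (quadD QP).
move: s^-1 => t.
by field; rewrite ?(bichar_neq0 bP) ?(quad_neq0 QP).
Qed.

Lemma gauss_sum_exp : gauss_sum Q ^+ (#|A| * (4 * (#|A| * 2))) = 1.
Proof.
(* The scalar matrix has determinant [gauss_sum Q ^+ #|A|]; the factors [4] and [#|A| * 2] of the
   exponent then kill [\det S] and [\det D]. *)
have : D *m S *m D *m S *m D *m S = (gauss_sum Q)%:M.
  by rewrite fourier_gauss -scalemxAl fourier_conj scalemx1.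
move/(congr1 determinant); rewrite det_scalar !det_mulmx => detE.
rewrite exprM -detE.
have detD : \det D ^+ (#|A| * 2) = 1.
  rewrite det_diag -prodrXl big1 // => j _.
  by rewrite mxE (quad_exp_card bP QP).
have detS : \det S ^+ 4 = 1.
  have := congr1 determinant fourier_exp4.
  by rewrite !det_mulmx det1 !exprS mulr1 !mulrA.
rewrite !exprMn ![_ ^+ (4 * _)]exprM detS expr1n -!exprM mulnC exprM detD.
by rewrite expr1n !mulr1.
Qed.

Lemma gauss_sum_norm : `|gauss_sum Q| = 1.
Proof.
apply/eqP; rewrite -(@pexpr_eq1 _ _ (#|A| * (4 * (#|A| * 2)))) //.
  by rewrite -normrX gauss_sum_exp normr1.
have A_gt0 : (0 < #|A|)%N by apply/card_gt0P; exists 0.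
by rewrite !muln_gt0 A_gt0.
Qed.

End GaussSum.

(** * Gaussian operators attached to a representation of [A] *)

Section GaussOperator.
Variables (C : numClosedFieldType) (A : finZmodType) (m : nat).
Implicit Types (T : A -> 'M[C]_m) (P : 'M[C]_m).

Definition gauss_op T (Q : A -> C) : 'M[C]_m :=
  (sqrt_card C A)^-1 *: \sum_(a : A) Q a *: T a.

Lemma gauss_op_mulr T Q P :
  gauss_op T Q *m P = (sqrt_card C A)^-1 *: \sum_a Q a *: (T a *m P).
Proof.
rewrite -scalemxAl mulmx_suml; congr (_ *: _).
by apply: eq_bigr => a _; rewrite scalemxAl.
Qed.

Lemma gauss_op_mull T Q P :
  P *m gauss_op T Q = (sqrt_card C A)^-1 *: \sum_a Q a *: (P *m T a).
Proof.
rewrite -scalemxAr mulmx_sumr; congr (_ *: _).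
by apply: eq_bigr => a _; rewrite scalemxAr.
Qed.

Lemma gauss_op_commute T Q P : (forall a, T a *m P = P *m T a) ->
  gauss_op T Q *m P = P *m gauss_op T Q.
Proof.
move=> TP; rewrite gauss_op_mulr gauss_op_mull.
by congr (_ *: _); apply: eq_bigr => a _; rewrite TP.
Qed.

Variables (b : A -> A -> C) (Q : A -> C) (T : A -> 'M[C]_m).
Hypotheses (bP : symmetric_bicharacter b) (QP : quadratic_for b Q).
Hypotheses (T0 : T 0 = 1%:M) (TD : forall x y, T (x + y) = T x *m T y).

(** Completing the square: after the substitution of [e + a] for [a], the factor [Q (e + a)]
    supplies the character [b e] and [T (- e)] undoes the shift of [T]. *)
Lemma gauss_op_conj P e : (forall a, T a *m P = b e a *: (P *m T a)) ->
  gauss_op T Q *m P = (Q e)^-1 *: (P *m T (- e) *m gauss_op T Q).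
Proof.
move=> TP; rewrite gauss_op_mulr gauss_op_mull scalerA mulrC -scalerA.
congr (_ *: _); rewrite scaler_sumr [RHS](reindex_inj (addrI e)) /=.
apply: eq_bigr => a _; rewrite TP -mulmxA -TD addKr !scalerA (quadD QP).
by rewrite -!mulrA mulKf // (quad_neq0 QP).
Qed.

Hypothesis b_nd : Defs.nondegenerate b.

(** The isotypic projection of [T] for the character [b e]. *)
Let proj e := #|A|%:R^-1 *: \sum_a b e (- a) *: T a.

Let mul_proj c e : T c *m proj e = b e c *: proj e.
Proof.
rewrite -scalemxAr mulmx_sumr scalerA mulrC -scalerA; congr (_ *: _).
rewrite scaler_sumr [RHS](reindex_inj (addrI c)) /=.
apply: eq_bigr => a _; rewrite -scalemxAr -TD scalerA; congr (_ *: _).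
by rewrite opprD -(bicharDr bP) addNKr.
Qed.

Let sum_proj : \sum_e proj e = 1%:M.
Proof.
rewrite -scaler_sumr exchange_big /=.
under eq_bigr => a _.
  rewrite -scaler_suml (eq_bigr _ (fun e _ => bicharC bP e (- a))).
  rewrite (sum_bichar bP b_nd) oppr_eq0; over.
rewrite (bigD1 0) //= eqxx mulr1 T0 big1 ?addr0 => [|a /negPf->].
  by rewrite scalerA mulVf ?scale1r // card_neq0.
by rewrite mulr0 scale0r.
Qed.

Let gauss_proj e : gauss_op T Q *m proj e = (gauss_sum Q / Q e) *: proj e.
Proof.
rewrite gauss_op_mulr; under eq_bigr => a _ do rewrite mul_proj scalerA.
rewrite -scaler_suml scalerA; congr (_ *: _).
exact: gauss_sum_shift.
Qed.

(** The isotypic projections diagonalise the operator with eigenvalues [gauss_sum Q / Q e], and the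
    exponent kills both the Gauss sum and the values of [Q]. *)
Lemma gauss_op_exp : gauss_op T Q ^+ (#|A| * (4 * (#|A| * 2))) = 1.
Proof.
set K := (#|A| * _)%N.
suff expG k e :
    gauss_op T Q ^+ k *m proj e = (gauss_sum Q / Q e) ^+ k *: proj e.
  rewrite -[LHS]mulmx1 -sum_proj mulmx_sumr -[RHS]sum_proj.
  apply: eq_bigr => e _; rewrite expG exprMn (gauss_sum_exp bP) // exprVn.
  by rewrite /K mulnA mulnC exprM (quad_exp_card bP QP) expr1n divr1 scale1r.
elim: k => [|k IHk]; first by rewrite expr0 mul1mx scale1r.
by rewrite exprSr -mulmxA gauss_proj -scalemxAr IHk scalerA -exprS.
Qed.

Hypothesis T_adj : forall a, (T a)^t* = T (- a).

(** In the product with the adjoint, substituting [a + c] for [a] leaves the coefficient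
    [Q a * b a c] on [T a]; summing over [c] kills every term but [a = 0]. *)
Lemma gauss_op_unitary : gauss_op T Q \is unitarymx.
Proof.
have -> : gauss_op T Q \is unitarymx =
    (gauss_op T Q *m gauss_op (fun a => T (- a)) (fun a => (Q a)^-1) == 1%:M).
  congr (_ *m _ == _); rewrite /gauss_op linearZ /= map_mxZ /= sqrt_card_conj.
  congr (_ *: _); rewrite linear_sum /= raddf_sum; apply: eq_bigr => a _.
  by rewrite linearZ /= map_mxZ /= T_adj (quad_conj QP).
rewrite gauss_op_mulr; under eq_bigr => a _.
  rewrite gauss_op_mull scalerA mulrC -scalerA scaler_sumr; over.
rewrite -scaler_sumr scalerA sqrt_cardV2 exchange_big /=.
under eq_bigr => c _.
  rewrite (reindex_inj (addIr c)) /=.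
  under eq_bigr => a _.
    rewrite scalerA -TD addrK (quadD QP) mulrAC mulfK ?(quad_neq0 QP) //; over.
  over.
rewrite exchange_big /=; under eq_bigr => a _.
  rewrite -scaler_suml -mulr_sumr (sum_bichar bP b_nd); over.
rewrite (bigD1 0) //= eqxx mulr1 T0 (quad0 bP QP) mul1r big1 ?addr0.
  by rewrite scalerA mulVf ?scale1r // card_neq0.
by move=> a /negPf->; rewrite !mulr0 scale0r.
Qed.


End GaussOperator.

Lemma gauss_op_commute2 (C : numClosedFieldType) (A : finZmodType) m
    (T S : A -> 'M[C]_m) Q P :
  (forall a c, T a *m S c = S c *m T a) ->
  gauss_op T Q *m gauss_op S P = gauss_op S P *m gauss_op T Q.
Proof.
by move=> TS; apply: gauss_op_commute => a; apply/esym/gauss_op_commute.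
Qed.

(** * Weyl operators and finiteness of the Clifford operators *)

Lemma finite_unity_roots (C : numClosedFieldType) k : (0 < k)%N ->
  finite_set [set z : C | z ^+ k = 1].
Proof.
move=> k_gt0.
have [rs rsE] := closed_field_poly_normal ('X^k - 1%:P : {poly C}).
apply: (@sub_finite_set _ _ [set` rs]); last exact: finite_seq.
move=> z /= zk; rewrite -root_prod_XsubC.
move: rsE; rewrite lead_coefXnsubC // scale1r => <-.
by rewrite rootE !hornerE zk subrr.
Qed.

Section Weyl.
Variables (C : numClosedFieldType) (L : finZmodType) (B : L -> L -> C).
Hypothesis BP : symmetric_bicharacter B.
Variables (m : nat) (g : 'I_m -> L).

(** This is X_u Z_w in a basis whose vectors are labelled by [L] through [g]. *)
Definition weyl (u w : L) : 'M[C]_m :=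
  \matrix_(i, j) ((g i == g j + u)%:R * B w (g j)).

Variable h : L -> 'I_m.
Hypotheses (gK : cancel g h) (hK : cancel h g).

Lemma mulmx_weyl (M : 'M[C]_m) u w i j :
  (M *m weyl u w) i j = M i (h (g j + u)) * B w (g j).
Proof.
rewrite mxE (bigD1 (h (g j + u))) //= mxE hK eqxx mul1r big1 ?addr0 // => k kj.
by rewrite mxE [g k == _](can2_eq gK hK) (negPf kj) mul0r mulr0.
Qed.

Lemma weyl_mulmx (M : 'M[C]_m) u w i j :
  (weyl u w *m M) i j = B w (g i - u) * M (h (g i - u)) j.
Proof.
rewrite mxE (bigD1 (h (g i - u))) //= mxE hK subrK eqxx mul1r.
rewrite big1 ?addr0 // => k ki; rewrite mxE -subr_eq -(can2_eq hK gK) eq_sym.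
by rewrite (negPf ki) !mul0r.
Qed.

Lemma weyl00 : weyl 0 0 = 1%:M.
Proof.
apply/matrixP => i j; rewrite !mxE addr0 (bichar0l BP) mulr1.
by rewrite (can_eq gK).
Qed.

Lemma weylM u w u' w' :
  weyl u w *m weyl u' w' = B w u' *: weyl (u + u') (w + w').
Proof.
apply/matrixP => i j; rewrite mulmx_weyl !mxE hK (bicharDl BP) (bicharDr BP).
rewrite -addrA [u' + u]addrC.
by case: eqP; rewrite ?mul0r ?mulr0 // => _; ring.
Qed.

Lemma weyl_swap u w u' w' :
  weyl u w *m weyl u' w' = (B w u' / B w' u) *: (weyl u' w' *m weyl u w).
Proof.
rewrite !weylM scalerA mulfVK ?(bichar_neq0 BP) //.
by rewrite [u' + u]addrC [w' + w]addrC.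
Qed.

Lemma weyl_adj u w : (weyl u w)^t* = B w u *: weyl (- u) (- w).
Proof.
apply/matrixP => i j; rewrite !mxE rmorphM /= conjC_nat (bichar_conj BP).
rewrite -subr_eq eq_sym -[RHS]mulrCA.
case: eqP => [->|]; last by rewrite !mul0r.
rewrite !mul1r (bicharNl BP) (bicharDr BP) (bicharNr BP).
by field; rewrite !(bichar_neq0 BP).
Qed.

Hypothesis B_nd : Defs.nondegenerate B.

(** Commuting with the phase operators kills the off-diagonal entries, by nondegeneracy; commuting
    with the shifts makes the diagonal constant. *)
Lemma weyl_commutant (M : 'M[C]_m) :
  (forall u w, M *m weyl u w = weyl u w *m M) -> exists c, M = c%:M.
Proof.
move=> Mcomm; have entry u w i j :
    M i (h (g j + u)) * B w (g j) = B w (g i - u) * M (h (g i - u)) j.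
  by rewrite -mulmx_weyl Mcomm weyl_mulmx.
exists (M (h 0) (h 0)); apply/matrixP => i j; rewrite mxE.
have [<-|ij] := eqVneq i j.
  have := entry (g i) 0 i (h 0).
  by rewrite hK add0r gK subrr !(bichar0l BP) mulr1 mul1r => ->.
have gij : g i - g j != 0 by rewrite subr_eq0 (can_eq gK).
have [w Bw] : exists w, B (g i - g j) w != 1.
  apply: contra_neqP gij => /forallNP B1; apply: B_nd => w.
  by apply/eqP; apply: contra_notT (B1 w).
apply: contraNeq Bw => Mij; move: (entry 0 w i j).
rewrite addr0 subr0 !gK mulrC => /(mulIf Mij) Bij.
rewrite (bicharDl BP) (bicharNl BP) !(bicharC BP _ w) -Bij.
by rewrite divff ?(bichar_neq0 BP).
Qed.

(** The action on Weyl operators ignores rescaling of [M]; the determinant condition is what bounds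
    the scalar. *)
Definition clifford K (M : 'M[C]_m) :=
  (forall u w, exists z u' w', z ^+ K = 1 /\
     M *m weyl u w = z *: (weyl u' w' *m M)) /\
  \det M ^+ K = 1.

Lemma clifford1 K : clifford K 1%:M.
Proof.
split=> [u w|]; last by rewrite det1 expr1n.
by exists 1, u, w; rewrite expr1n mul1mx mulmx1 scale1r.
Qed.

Lemma cliffordM K M N : clifford K M -> clifford K N -> clifford K (M *m N).
Proof.
case=> [conjM detM] [conjN detN]; split=> [u w|]; last first.
  by rewrite det_mulmx exprMn detM detN mulr1.
have [z [u1 [w1 [zK NW]]]] := conjN u w.
have [y [u2 [w2 [yK MW]]]] := conjM u1 w1.
exists (z * y), u2, w2; rewrite exprMn zK yK mulr1; split=> //.
rewrite -mulmxA NW -scalemxAr [M *m (_ *m N)]mulmxA MW -scalemxAl scalerA.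
by rewrite -mulmxA.
Qed.

Lemma cliffordX K k M : clifford K M -> clifford K (M ^+ k).
Proof.
move=> cM; elim: k => [|k IHk]; first exact: clifford1.
by rewrite exprS; exact: cliffordM.
Qed.

Lemma cliffordZ K c M : c ^+ K = 1 -> clifford K M -> clifford K (c *: M).
Proof.
move=> cK [conjM detM]; split=> [u w|].
  have [z [u' [w' [zK MW]]]] := conjM u w; exists z, u', w'; split=> //.
  by rewrite -scalemxAl MW -scalemxAr !scalerA mulrC.
by rewrite detZ exprMn detM -exprM mulnC exprM cK expr1n mulr1.
Qed.

(** For a unitary [M] of order dividing [K], the adjoint is the power [M ^+ K.-1]. *)
Lemma clifford_adj K M :
    (0 < K)%N ->
    M \is unitarymx -> M ^+ K = 1 ->
  clifford K M -> clifford K (M^t*).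
Proof.
move=> K_gt0 /unitarymxP MMadj MK cM.
suff -> : M^t* = M ^+ K.-1 by exact: cliffordX.
by rewrite -[RHS]mulmx1 -MMadj mulmxA -[X in X *m _]exprSr prednK // MK mul1mx.
Qed.

Lemma finite_clifford K : (0 < K)%N -> finite_set (clifford K).
Proof.
move=> K_gt0; have m_gt0 : (0 < m)%N by case: (h 0) => k; case: (m).
have /finite_seqP[rs rsE] := @finite_unity_roots C K K_gt0.
have mem_rs z : z ^+ K = 1 -> exists2 k : 'I_(size rs), z = rs`_k & true.
  move=> zK; have z_rs : z \in rs by change ([set` rs] z); rewrite -rsE.
  by exists (Ordinal (etrans (index_mem z rs) z_rs)); rewrite //= nth_index.
pose F := {ffun L * L -> 'I_(size rs) * (L * L)}.
(* A fibre prescribes, for each Weyl operator, the position of the phase in [rs] and the labels of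
   the image: finitely many prescriptions. *)
pose fiber (f : F) := [set M | \det M ^+ K = 1 /\ forall v,
  M *m weyl v.1 v.2 = rs`_(f v).1 *: (weyl (f v).2.1 (f v).2.2 *m M)].
apply: (@sub_finite_set _ _ (\bigcup_(f in setT) fiber f)).
  move=> M [conjM detM].
  have /choice[f fP] : forall v : L * L, exists f : 'I_(size rs) * (L * L),
      M *m weyl v.1 v.2 = rs`_f.1 *: (weyl f.2.1 f.2.2 *m M).
    move=> [u w]; have [z [u' [w' [/mem_rs[k -> _] MW]]]] := conjM u w.
    by exists (k, (u', w')).
  by exists (finfun f) => //; split=> // v; rewrite ffunE.
apply: bigcup_finite => [|f _]; first exact: finite_finset.
have [->//|/set0P[M0 [detM0 conjM0]]] := eqVneq (fiber f) set0.
have M0_unit : M0 \in unitmx.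
  rewrite unitmxE unitfE; apply: contra_eqN detM0 => /eqP->.
  by rewrite expr0n eqn0Ngt K_gt0 eq_sym oner_eq0.
have mK_gt0 : (0 < m * K)%N by rewrite muln_gt0 m_gt0.
apply: (@sub_finite_set _ _
    [set c *: M0 | c in [set c : C | c ^+ (m * K) = 1]]);
  last exact/finite_image/finite_unity_roots.
(* Two members of a fibre act alike on Weyl operators, so their quotient is a scalar; comparing
   determinants makes it an [m * K]-th root of unity. *)
move=> M [detM conjM]; have [u w|c cE] := @weyl_commutant (invmx M0 *m M).
  rewrite -mulmxA (conjM (u, w)) -scalemxAr.
  apply: (can_inj (mulKmx M0_unit)).
  rewrite -[in LHS]scalemxAr mulKVmx // !mulmxA (conjM0 (u, w)).
  by rewrite -!scalemxAl mulmxK.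
have ME : M = c *: M0.
  by rewrite -[M](mulKVmx M0_unit) cE mul_mx_scalar.
exists c => //=; move: detM.
by rewrite ME detZ exprMn detM0 mulr1 exprM.
Qed.

End Weyl.

(** * The Yang-Baxter equation from commutation relations *)

Section YangBaxter.
Variables (C : numClosedFieldType) (A : finZmodType) (m : nat).
Implicit Types (X Y Z : 'M[C]_m) (T S : A -> 'M[C]_m).

(** For invertible [X], this says that conjugation by [X] sends [Y] to [c *: Y']; no inverse is
    formed. *)
Definition carries X (c : C) Y Y' := X *m Y = c *: (Y' *m X).

Lemma carries_comm X Y : X *m Y = Y *m X -> carries X 1 Y Y.
Proof. by rewrite /carries scale1r. Qed.

Lemma carries_comp X1 X2 c1 c2 Y Y1 Y2 :
  carries X1 c1 Y Y1 -> carries X2 c2 Y1 Y2 ->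
  carries (X2 *m X1) (c1 * c2) Y Y2.
Proof.
rewrite /carries => X1Y X2Y.
rewrite -mulmxA X1Y -scalemxAr [X2 *m (_ *m X1)]mulmxA X2Y -scalemxAl scalerA.
by rewrite -mulmxA.
Qed.

Lemma carries_mul X c Y Y' d Z Z' :
  carries X c Y Y' -> carries X d Z Z' -> carries X (c * d) (Y *m Z) (Y' *m Z').
Proof.
rewrite /carries => XY XZ.
rewrite mulmxA XY -scalemxAl -[Y' *m X *m Z]mulmxA XZ -scalemxAr scalerA.
by rewrite mulmxA.
Qed.

Lemma gauss_op_carries X T S Q P (f f' : A -> A) (c : A -> C) :
    cancel f f' -> cancel f' f ->
    (forall a, carries X (c a) (T a) (S (f a))) ->
    (forall a, Q a * c a = P (f a)) ->
  X *m gauss_op T Q = gauss_op S P *m X.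
Proof.
move=> fK f'K XT cP; rewrite gauss_op_mull gauss_op_mulr; congr (_ *: _).
rewrite [RHS](reindex f) /=; last by exists f' => a _; rewrite ?fK ?f'K.
by apply: eq_bigr => a _; rewrite XT scalerA cP.
Qed.

Definition matrix_rep T :=
  T 0 = 1%:M /\ forall x y, T (x + y) = T x *m T y.

Lemma matrix_repC T x y : matrix_rep T -> T x *m T y = T y *m T x.
Proof. by case=> _ TD; rewrite -!TD addrC. Qed.

Lemma matrix_repNr T x : matrix_rep T -> T x *m T (- x) = 1%:M.
Proof. by case=> T0 TD; rewrite -TD subrr. Qed.

(** Conjugation by [G1 *m G2] sends [T1 a] to [Q (- a) / Q a] times [T2 (- a)], so it carries [G1]
    to [G2] term by term. *)
Lemma gauss_op_YB (b : A -> A -> C) Q T1 T2 :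
    symmetric_bicharacter b -> quadratic_for b Q ->
    matrix_rep T1 -> matrix_rep T2 ->
    (forall a c, T2 a *m T1 c = b a c *: (T1 c *m T2 a)) ->
  let G1 := gauss_op T1 Q in let G2 := gauss_op T2 Q in
  G1 *m G2 *m G1 = G2 *m G1 *m G2.
Proof.
move=> bP QP T1P T2P T21 G1 G2.
have T12 a c : T1 a *m T2 c = b (- c) a *: (T2 c *m T1 a).
  by rewrite T21 (bicharNl bP) scalerA mulVf ?scale1r ?(bichar_neq0 bP).
have G2T1 a : carries G2 (Q a)^-1 (T1 a) (T1 a *m T2 (- a)).
  apply: (gauss_op_conj QP T2P.2) => c.
  by rewrite T21 (bicharC bP).
have G1T2 a : carries G1 (Q (- a))^-1 (T2 a) (T2 a *m T1 a).
  have := gauss_op_conj QP T1P.2 (fun c => T12 c a).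
  by rewrite opprK.
have G1T1 a : carries G1 1 (T1 a) (T1 a).
  by apply/carries_comm/gauss_op_commute => c; exact: matrix_repC.
rewrite -[RHS]mulmxA; apply: (@gauss_op_carries _ _ _ _ _ -%R -%R
  (fun a => Q (- a) / Q a)); [exact: opprK | exact: opprK | | ]; last first.
  by move=> a; field; exact: quad_neq0 QP a.
move=> a.
(* [G2] appends [T2 (- a)] to [T1 a]; [G1] then appends [T1 (- a)], which cancels [T1 a] at the cost
   of the phase [b a a]. *)
have := carries_comp (G2T1 a) (carries_mul (G1T1 a) (G1T2 (- a))).
rewrite /carries opprK mul1r T21 -[T1 a *m (_ *: _)]scalemxAr.
rewrite [T1 a *m (T1 _ *m _)]mulmxA matrix_repNr // mul1mx.
rewrite -[(_ *: T2 _) *m _]scalemxAl scalerA (bicharNl bP) (bicharNr bP) invrK.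
rewrite -(quadN bP QP) => ->; congr (_ *: _).
by field; exact: quad_neq0 QP a.
Qed.

(* Write [R1 = U1 *m W1] and [R2 = U2 *m W2]: conjugation by [R1 *m R2] swaps the
   two kinds of Gaussian factors, sending [U1] to [W2] and [W1] to [U2]. *)
Lemma gauss_op2_YB (b : A -> A -> C) (E F : A -> A) Q P T1 T2 S1 S2 :
    symmetric_bicharacter b ->
    cancel E F -> cancel F E -> {morph E : x y / x + y} ->
    symmetric_bicharacter (fun x y => b (E x) y) ->
    symmetric_bicharacter (fun x y => b (F x) y) ->
    quadratic_for (fun x y => b (E x) y) Q ->
    quadratic_for (fun x y => b (F x) y) P ->
    matrix_rep T1 -> matrix_rep T2 -> matrix_rep S1 -> matrix_rep S2 ->
    (forall a c, T1 a *m T2 c = T2 c *m T1 a) ->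
    (forall a c, S1 a *m S2 c = S2 c *m S1 a) ->
    (forall a c, T1 a *m S1 c = S1 c *m T1 a) ->
    (forall a c, T2 a *m S2 c = S2 c *m T2 a) ->
    (forall a c, T1 a *m S2 c = b a c *: (S2 c *m T1 a)) ->
    (forall a c, S1 a *m T2 c = b a c *: (T2 c *m S1 a)) ->
  let R1 := gauss_op T1 Q *m gauss_op S1 P in
  let R2 := gauss_op T2 Q *m gauss_op S2 P in
  R1 *m R2 *m R1 = R2 *m R1 *m R2.
Proof.
move=> bP EK FK ED bEP bFP QP PP T1P T2P S1P S2P.
move=> T12 S12 TS1 TS2 T1S2 S1T2 R1 R2.
pose U1 := gauss_op T1 Q; pose U2 := gauss_op T2 Q.
pose W1 := gauss_op S1 P; pose W2 := gauss_op S2 P.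
have EN x : E (- x) = - E x.
  have E0 : E 0 = 0 by apply: (addrI (E 0)); rewrite -ED !addr0.
  by apply: (addrI (E x)); rewrite -ED !subrr.
have FN x : F (- x) = - F x by apply: (can_inj EK); rewrite EN !FK.
have comm T Q' X :
    (forall a, T a *m X = X *m T a) -> carries (gauss_op T Q') 1 X X.
  by move=> TX; apply/carries_comm/gauss_op_commute.
(* Moving [S2 c] past [T1 t] gives the inverse of [b t c], the character attached to [- E t] by the
   form of [P], because [F (E t) = t]. *)
have W2T1 t : carries W2 (P (- E t))^-1 (T1 t) (T1 t *m S2 (E t)).
  rewrite -[in S2 _](opprK (E t)); apply: (gauss_op_conj PP S2P.2) => c.
  by rewrite T1S2 scalerA FN EK (bicharNl bP) mulVf ?scale1r ?(bichar_neq0 bP).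
have U1T1S2 t : carries U1 ((Q t)^-1 * b t (E t)) (T1 t *m S2 (E t)) (S2 (E t)).
  have U1S2 : carries U1 (Q t)^-1 (S2 (E t)) (S2 (E t) *m T1 (- t)).
    by apply: (gauss_op_conj QP T1P.2) => c; rewrite T1S2 (bicharC bP).
  have := carries_mul (comm T1 Q _ (fun a => matrix_repC a t T1P)) U1S2.
  rewrite /carries mul1r => ->; rewrite mulmxA T1S2 -[_ *m T1 (- t)]scalemxAl.
  by rewrite -[_ *m T1 t *m _]mulmxA matrix_repNr // mulmx1 -scalemxAl scalerA.
have U2S1 c : carries U2 (Q (- F c))^-1 (S1 c) (S1 c *m T2 (F c)).
  rewrite -[in T2 _](opprK (F c)); apply: (gauss_op_conj QP T2P.2) => a.
  by rewrite S1T2 scalerA EN FK (bicharNl bP) mulVf ?scale1r ?(bichar_neq0 bP).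
have W1S1T2 c : carries W1 ((P c)^-1 * b c (F c)) (S1 c *m T2 (F c)) (T2 (F c)).
  have W1T2 : carries W1 (P c)^-1 (T2 (F c)) (T2 (F c) *m S1 (- c)).
    by apply: (gauss_op_conj PP S1P.2) => a; rewrite S1T2 (bicharC bP).
  have := carries_mul (comm S1 P _ (fun a => matrix_repC a c S1P)) W1T2.
  rewrite /carries mul1r => ->; rewrite mulmxA S1T2 -[_ *m S1 (- c)]scalemxAl.
  by rewrite -[_ *m S1 c *m _]mulmxA matrix_repNr // mulmx1 -scalemxAl scalerA.
have R12E : R1 *m R2 = U1 *m (W1 *m (U2 *m W2)) by rewrite mulmxA.
have quadE t : Q t * Q (- t) = b t (E t).
  by rewrite (quadN bEP QP) (bicharC bP).
(* Applying [W2], [U2], [W1], [U1] in turn: [W2] appends [S2 (E t)] to [T1 t], the next two fix the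
   result, and [U1] strips off [T1 t]. *)
have R12U1 : R1 *m R2 *m U1 = W2 *m (R1 *m R2).
  apply: (@gauss_op_carries _ _ _ _ _ E F
    (fun t => Q (- t) / P (- E t))) => // t.
    have := carries_comp (W2T1 t) (carries_mul
      (comm T2 Q _ (fun a => esym (T12 t a)))
      (comm T2 Q _ (fun a => TS2 a (E t)))).
    move=> /carries_comp/(_ (carries_mul
      (comm S1 P _ (fun a => esym (TS1 t a)))
      (comm S1 P _ (fun a => S12 a (E t))))).
    move=> /carries_comp/(_ (U1T1S2 t)); rewrite -R12E !mulr1 -quadE.
    by rewrite mulKf ?(quad_neq0 QP) // mulrC.
  have := quadN bFP PP (E t); rewrite EK mulrA quadE => <-.
  by rewrite mulfK // (quad_neq0 PP).
(* Dually, [W2] fixes [S1 c], [U2] appends [T2 (F c)], [W1] strips off [S1 c], and [U1] fixes the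
   rest. *)
have R12W1 : R1 *m R2 *m W1 = U2 *m (R1 *m R2).
  apply: (@gauss_op_carries _ _ _ _ _ F E
    (fun c => Q (F c) / P c)) => // c; last first.
    by rewrite mulrC mulfVK ?(quad_neq0 PP).
  have := carries_comp (comm S2 P _ (fun a => esym (S12 c a))) (U2S1 c).
  move=> /carries_comp/(_ (W1S1T2 c)).
  move=> /carries_comp/(_ (comm T1 Q _ (fun a => T12 a (F c)))).
  have := quadE (F c); rewrite FK (bicharC bP) -R12E mul1r mulr1 => <-.
  congr carries.
  by field; rewrite !((quad_neq0 PP), (quad_neq0 QP)).
have W2U2 : W2 *m U2 = U2 *m W2 by apply/esym/gauss_op_commute2.
rewrite [LHS]mulmxA R12U1 -[W2 *m _ *m _]mulmxA R12W1 [LHS]mulmxA W2U2.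
by rewrite [LHS]mulmxA.
Qed.

End YangBaxter.

(** * Gaussian operators built from Weyl operators *)

Lemma det_expr (C : comNzRingType) m (M : 'M[C]_m) k :
  \det (M ^+ k) = \det M ^+ k.
Proof. by elim: k => [|k IHk]; rewrite ?det1 // !exprS det_mulmx IHk. Qed.

Section WeylGauss.
Variables (C : numClosedFieldType) (A L : finZmodType) (B : L -> L -> C).
Hypothesis BP : symmetric_bicharacter B.
Variables (m : nat) (g : 'I_m -> L) (h : L -> 'I_m).
Hypotheses (gK : cancel g h) (hK : cancel h g).
Variables (u w : A -> L).
Hypotheses (uD : {morph u : x y / x + y}) (wD : {morph w : x y / x + y}).
Hypothesis wu1 : forall a c, B (w a) (u c) = 1.

Definition weyl_rep a := weyl B g (u a) (w a).

(** Weyl operators multiply up to the phases [B (w a) (u c)]; these being trivial, a genuine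
    representation results. *)
Lemma weyl_repP : matrix_rep weyl_rep.
Proof.
have u0 : u 0 = 0 by apply: (addrI (u 0)); rewrite -uD !addr0.
have w0 : w 0 = 0 by apply: (addrI (w 0)); rewrite -wD !addr0.
split=> [|x y]; first by rewrite /weyl_rep u0 w0 (weyl00 BP gK).
by rewrite /weyl_rep uD wD (weylM BP gK hK) wu1 scale1r.
Qed.

Lemma weyl_rep_adj a : (weyl_rep a)^t* = weyl_rep (- a).
Proof.
have u0 : u 0 = 0 by apply: (addrI (u 0)); rewrite -uD !addr0.
have w0 : w 0 = 0 by apply: (addrI (w 0)); rewrite -wD !addr0.
rewrite weyl_adj // wu1 scale1r; congr (weyl _ _ _ _).
  by apply: (addrI (u a)); rewrite -uD !subrr.
by apply: (addrI (w a)); rewrite -wD !subrr.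
Qed.

Variables (b : A -> A -> C) (Q : A -> C).
Hypotheses (bP : symmetric_bicharacter b) (QP : quadratic_for b Q).
Hypothesis b_nd : Defs.nondegenerate b.
Hypothesis B_exp : forall x y, B x y ^+ #|A| = 1.
(* Every character of [A] has the form [b e]; the witness is supplied explicitly
   for each system of Weyl operators instead of being obtained by duality. *)
Hypothesis dual : forall x y, exists e, forall a, B (w a) x / B y (u a) = b e a.

Let K := (#|A| * (4 * (#|A| * 2)))%N.

Lemma weyl_gauss_unitary : gauss_op weyl_rep Q \is unitarymx.
Proof.
have [T0 TD] := weyl_repP.
exact: (gauss_op_unitary bP QP T0 TD b_nd weyl_rep_adj).
Qed.

Lemma weyl_gauss_exp : gauss_op weyl_rep Q ^+ K = 1.
Proof.
have [T0 TD] := weyl_repP.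
exact: (gauss_op_exp bP QP T0 TD b_nd).
Qed.

Lemma weyl_gauss_clifford : clifford B g K (gauss_op weyl_rep Q).
Proof.
have [T0 TD] := weyl_repP.
split=> [x y|]; last by rewrite -det_expr weyl_gauss_exp det1.
have [e eP] := dual x y.
(* Conjugation contributes the inverse of [Q e] and the operator at [- e]; merging the latter with
   [weyl x y] contributes [B y (u (- e))]. *)
exists ((Q e)^-1 * B y (u (- e))), (x + u (- e)), (y + w (- e)); split.
  rewrite exprMn exprVn /K [in B _ _ ^+ _]exprM B_exp expr1n mulr1.
  by rewrite mulnA mulnC exprM (quad_exp_card bP QP) expr1n invr1.
rewrite (gauss_op_conj QP TD (e := e)) => [|a].
  by rewrite (weylM BP gK hK) -scalemxAl scalerA.
by rewrite (weyl_swap BP gK hK) eP.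
Qed.

End WeylGauss.

Lemma weyl_rep_swap (C : numClosedFieldType) (A L : finZmodType)
    (B : L -> L -> C) m (g : 'I_m -> L) h (u w u' w' : A -> L) a c z :
    symmetric_bicharacter B -> cancel g h -> cancel h g ->
    B (w a) (u' c) = z * B (w' c) (u a) ->
  weyl_rep B g u w a *m weyl_rep B g u' w' c =
    z *: (weyl_rep B g u' w' c *m weyl_rep B g u w a).
Proof.
move=> BP gK hK BE.
by rewrite [LHS](weyl_swap BP gK hK) BE mulfK ?(bichar_neq0 BP).
Qed.

(** * The label group of functions from strands to [A], with its product bicharacter *)

HB.instance Definition _ (I : finType) (A : finZmodType) :=
  Finite.on {ffun I -> A}.

Section ProductBicharacter.
Variables (C : numClosedFieldType) (A : finZmodType).
Variables (b : A -> A -> C) (n : nat).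
Hypothesis bP : symmetric_bicharacter b.

Definition prod_bichar (x y : {ffun 'I_n -> A}) : C := \prod_k b (x k) (y k).

Lemma prod_bicharP : symmetric_bicharacter prod_bichar.
Proof.
have norm1 x y : `|prod_bichar x y| = 1.
  by rewrite normr_prod big1 // => k _; rewrite (bichar_norm bP).
split=> [x|y|x y]; [split=> [y|y z] | split=> [x|x z] | ]; rewrite ?norm1 //.
- by rewrite -big_split; apply: eq_bigr => k _; rewrite ffunE (bicharDr bP).
- by rewrite -big_split; apply: eq_bigr => k _; rewrite ffunE (bicharDl bP).
- by apply: eq_bigr => k _; rewrite (bicharC bP).
Qed.

Lemma prod_bichar_exp x y : prod_bichar x y ^+ #|A| = 1.
Proof. by rewrite -prodrXl big1 // => k _; rewrite (bichar_exp_card bP). Qed.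

Definition single (k : 'I_n) (a : A) : {ffun 'I_n -> A} :=
  [ffun j => if j == k then a else 0].

Lemma singleD k : {morph single k : x y / x + y}.
Proof.
by move=> x y; apply/ffunP => j; rewrite !ffunE; case: eqP; rewrite ?addr0.
Qed.

Lemma single0 k : single k 0 = 0.
Proof. by apply/ffunP => j; rewrite !ffunE if_same. Qed.

Lemma prod_bichar_single k a y : prod_bichar (single k a) y = b a (y k).
Proof.
rewrite /prod_bichar (bigD1 k) //= big1 => [|j /negPf jk].
  by rewrite ffunE eqxx mulr1.
by rewrite ffunE jk (bichar0l bP).
Qed.

Lemma prod_bichar_nd : Defs.nondegenerate b -> Defs.nondegenerate prod_bichar.
Proof.
move=> b_nd x xP; apply/ffunP => k; rewrite ffunE; apply: b_nd => a.
by rewrite (bicharC bP) -prod_bichar_single (bicharC prod_bicharP).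
Qed.

End ProductBicharacter.

Arguments prod_bichar {C A} b {n} x y.

(** * Digits in base [#|A|] as labels of the tensor basis *)

Lemma eqn_mod_digits d m x y :
  reflect (forall k, (k < m)%N -> x %/ d ^ k = y %/ d ^ k %[mod d])%N
    (x %% d ^ m == y %% d ^ m)%N.
Proof.
apply: (iffP eqP) => [xy k km|].
  have dvd : (d * d ^ k %| d ^ m)%N by rewrite -expnS dvdn_exp2l.
  by rewrite !modn_divl -(modn_dvdm x dvd) xy modn_dvdm.
elim: m => [|m IHm] xy; first by rewrite !modn1.
rewrite (divn_eq (x %% _) (d ^ m)) (divn_eq (y %% _) (d ^ m)) expnS -!modn_divl.
rewrite xy //.
by rewrite !modn_dvdm ?dvdn_mull // IHm // => k km; apply: xy; exact: ltnW.
Qed.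

Section Digits.
Variables (A : finZmodType) (n : nat).
Local Notation d := #|A|.

Lemma finzmod_gt0 : (0 < d)%N.
Proof. by apply/card_gt0P; exists 0. Qed.

(** The digit of weight [d ^ k], read in [A] through the same enumeration that indexes [shift_mx]
    and [phase_mx]. *)
Definition digit (k x : nat) : A :=
  enum_val (Ordinal (ltn_pmod (x %/ d ^ k) finzmod_gt0)).

Lemma eq_digit k x y :
  (digit k x == digit k y) = (x %/ d ^ k == y %/ d ^ k %[mod d])%N.
Proof. by rewrite (inj_eq enum_val_inj). Qed.

Definition digits (x : 'I_(d ^ n)) : {ffun 'I_n -> A} :=
  [ffun k : 'I_n => digit k x].

Lemma digits_inj : injective digits.
Proof.
move=> x y /ffunP xy; apply: val_inj => /=.
rewrite -(modn_small (ltn_ord x)) -(modn_small (ltn_ord y)).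
apply/eqP/eqn_mod_digits => k kn; apply/eqP; rewrite -eq_digit.
by have := xy (Ordinal kn); rewrite !ffunE => ->.
Qed.

Lemma digits_bij : bijective digits.
Proof. by apply: (inj_card_bij digits_inj); rewrite card_ffun !card_ord. Qed.

Variable i : 'I_n.-1.

Lemma strandl_subproof : (n - i.+1 < n)%N.
Proof. by rewrite ltn_subrL /=; case: n i => // -[]. Qed.

Lemma strandr_subproof : (n - i.+2 < n)%N.
Proof. by rewrite ltn_subrL /=; case: n i => // -[]. Qed.

(* Strand [0] carries the most significant digit. *)
Definition strandl : 'I_n := Ordinal strandl_subproof.
Definition strandr : 'I_n := Ordinal strandr_subproof.

Lemma strand_succ : strandl = strandr.+1 :> nat.
Proof.
by rewrite /= subnSK //; case: n i => [[]|[[]|N i']] //=; rewrite ltnS.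
Qed.

(** The right side follows the Kronecker layout of [local_op]: the digits above the two active
    strands, those below, and the two active digits. *)
Lemma digits_local (x y : 'I_(d ^ n)) a c :
  (digits x == digits y + (single strandl a + single strandr c)) =
  [&& (x %/ d ^ strandr %/ (d * d) == y %/ d ^ strandr %/ (d * d))%N,
      (x == y %[mod d ^ strandr])%N,
      digit strandl x == digit strandl y + a &
      digit strandr x == digit strandr y + c].
Proof.
move: strandl strandr strand_succ => l r lrS.
have lr : l != r by rewrite -val_eqE /= lrS gtn_eqF.
have r_lt : (r.+1 < n)%N by rewrite -lrS.
have hiE z : (z %/ d ^ r %/ (d * d) = z %/ d ^ r.+2)%N.
  by rewrite -divnMA mulnn -expnD addn2.
rewrite !hiE; apply/eqP/and4P => [/ffunP xy|[/eqP hi lo /eqP xl /eqP xr]].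
  have xyE k : (k < n)%N -> k != l -> k != r ->
      (x %/ d ^ k = y %/ d ^ k %[mod d])%N.
    move=> kn /negPf kl /negPf kr; apply/eqP; rewrite -eq_digit.
    by have := xy (Ordinal kn); rewrite !ffunE -!val_eqE /= kl kr !addr0 => ->.
  have lt_hi (z : 'I_(d ^ n)) : (z %/ d ^ r.+2 < d ^ (n - r.+2))%N.
    by rewrite ltn_divLR ?expn_gt0 ?finzmod_gt0 // -expnD subnK.
  split.
  - rewrite -(modn_small (lt_hi x)) -(modn_small (lt_hi y)).
    apply/eqn_mod_digits => k kn; rewrite -!divnMA -expnD.
    by apply: xyE; rewrite ?lrS; lia.
  - apply/eqn_mod_digits => k kr; apply: xyE; rewrite ?lrS; last 2 first.
    + by lia.
    + by lia.
    by apply: ltn_trans kr _.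
  - by have := xy l; rewrite !ffunE eqxx (negPf lr) addr0 => ->.
  - by have := xy r; rewrite !ffunE eqxx eq_sym (negPf lr) add0r => ->.
apply/ffunP => k; rewrite !ffunE.
have [->|kl] := eqVneq k l; first by rewrite (negPf lr) addr0.
have [->|kr] := eqVneq k r; first by rewrite add0r.
rewrite !addr0; apply/eqP; rewrite eq_digit.
move: kl kr; rewrite -!val_eqE /= => kl kr.
have [k_lt|k_gt|k_eq] := ltngtP k r; last by rewrite k_eq eqxx in kr.
  by apply/eqP; move/eqn_mod_digits: lo; apply.
have k_hi : (r.+2 <= k)%N.
  by move: kl; rewrite lrS; lia.
by rewrite -(subnKC k_hi) expnD !(divnMA _ (d ^ r.+2)%N) hi.
Qed.

End Digits.

(** * Local operators as Weyl operators on all strands *)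

Section LocalOp.
Variables (C : numClosedFieldType) (A : finZmodType) (n : nat) (i : 'I_n.-1).
Local Notation d := #|A|.

Lemma local_opZ c (M : 'M[C]_(d * d)) : local_op (c *: M) i = c *: local_op M i.
Proof.
by apply/matrixP => x y; rewrite /local_op !(castmxE, mxE); ring.
Qed.

Lemma local_op_sum (I : finType) (F : I -> 'M[C]_(d * d)) :
  local_op (\sum_k F k) i = \sum_k local_op (F k) i.
Proof.
have op0 : local_op (0 : 'M[C]_(d * d)) i = 0.
  by apply/matrixP => x y; rewrite /local_op !(castmxE, mxE); ring.
apply: (big_morph (fun M : 'M[C]_(d * d) => local_op M i) _ op0) => M N.
by apply/matrixP => x y; rewrite /local_op !(castmxE, mxE); ring.
Qed.

Lemma shift_phaseE (q : A -> C) a c j k :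
  (shift_mx C a *m phase_mx q c) j k =
    (enum_val j == enum_val k + a)%:R * pairing q c (enum_val k).
Proof. by rewrite mul_mx_diag !mxE. Qed.

Lemma local_op_weyl (q : A -> C) a c a' c' :
    symmetric_bicharacter (pairing q) ->
  local_op ((shift_mx C a *m phase_mx q c) *t
            (shift_mx C a' *m phase_mx q c')) i =
  weyl (prod_bichar (pairing q)) (@digits A n)
    (single (strandl i) a + single (strandr i) a')
    (single (strandl i) c + single (strandr i) c').
Proof.
move=> bP; apply/matrixP => x y; rewrite /local_op castmxE [RHS]mxE.
rewrite [LHS]mxE [X in X * _]mxE [X in _ * X * _]mxE !shift_phaseE.
rewrite ![1%:M _ _]mxE.
(* [mid] extracts the index pair of the middle factor V (x) V, whose components are the two active
   digits. *)
pose mid (z : 'I_(d ^ n)) := mxtens_unindex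
  (mxtens_unindex (mxtens_unindex (cast_ord (esym (braid_dim d i)) z)).1).2.
have midl z : enum_val (mid z).1 = digit A (strandl i) z.
  congr enum_val; apply: val_inj; rewrite /= -modn_divl -divnMA -expnSr.
  by congr (_ %/ _ ^ _ %% _)%N; rewrite -strand_succ.
have midr z : enum_val (mid z).2 = digit A (strandr i) z.
  by congr enum_val; apply: val_inj; rewrite /= modn_dvdm ?dvdn_mull.
rewrite /= -!/(mid _) !midl !midr digits_local -!val_eqE /=.
rewrite (bicharDl (prod_bicharP n bP)) !prod_bichar_single // !ffunE.
by do 4?[case: eqP => _]; rewrite ?(mul0r, mulr0, mul1r, mulr1).
Qed.

End LocalOp.

(** * Existence of the braid group representation *)

Section BraidRepExistence.
Variables (C : numClosedFieldType) (d n : nat) (R : 'M[C]_(d * d)).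
Local Notation U := (unitary_group C (d ^ n)).
Local Notation Rop := (local_op R).
Hypothesis R_unitary : forall i : 'I_n.-1, Rop i \is unitarymx.
Hypothesis R_far : forall i j : 'I_n.-1, (i.+1 < j)%N ->
  Rop i *m Rop j = Rop j *m Rop i.
Hypothesis R_near : forall i j : 'I_n.-1, j = i.+1 :> nat ->
  Rop i *m Rop j *m Rop i = Rop j *m Rop i *m Rop j.

Let gen i : U := UnitaryMx (R_unitary i).
Let letter (l : 'I_n.-1 * bool) : U := if l.2 then (gen l.1)^-1%g else gen l.1.
Let eval (u : braid_word n) : U := (\prod_(l <- u) letter l)%g.

Let eval_eqv u v : braid_eqv u v -> eval u = eval v.
Proof.
elim=> {u v}
  [u|u v _ ->|u v w _ -> _ ->|u u' v v' _ uu' _ vv'|i b|i j ij|i j ij] //.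
- by rewrite /eval !big_cat; congr (_ * _)%g.
- rewrite /eval !big_cons !big_nil mulg1.
  by case: b; rewrite /letter /= ?mulVg ?mulgV.
- rewrite /eval !big_cons !big_nil !mulg1; apply: val_inj; exact: R_far.
- rewrite /eval !big_cons !big_nil !mulg1 !mulgA; apply: val_inj; exact: R_near.
Qed.

Let rho (x : braid_group n) : U := eval (generic_quotient.repr x).

Let rhoE u : rho (braid_of u) = eval u.
Proof. by apply/eval_eqv/braid_ofP/braid_of_repr. Qed.

Let rhoM : {morph rho : x y / (x * y)%g}.
Proof. by move=> x y; rewrite [LHS]rhoE /eval big_cat. Qed.

(** The multiplicative predicate [Pd] locates the image while the words are evaluated; its last
    hypothesis handles inverse letters. *)
Lemma braid_rep_exists (Pd : 'M[C]_(d ^ n) -> Prop) :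
    Pd 1%:M -> (forall M N, Pd M -> Pd N -> Pd (M *m N)) ->
    (forall i : 'I_n.-1, Pd (Rop i)) -> (forall i : 'I_n.-1, Pd ((Rop i)^t*)) ->
  exists2 f : {multiplicative braid_group n -> U},
    is_braid_rep R f & forall x, Pd (f x).
Proof.
move=> P1 PM PR PRV.
pose rho_mul := isMultiplicative.Build (braid_group n) U rho rhoM.
pose f : {multiplicative braid_group n -> U} := HB.pack rho rho_mul.
exists f => [i|x].
  by rewrite /= rhoE /eval big_seq1.
rewrite /= /rho /eval; elim: (generic_quotient.repr x) => [|[i b] u IHu].
  by rewrite big_nil.
by rewrite big_cons; apply: PM => //; case: b; [exact: PRV|exact: PR].
Qed.

End BraidRepExistence.

(** * A criterion for a finite image *)

Lemma exprZmx (C : comPzRingType) m (c : C) (M : 'M[C]_m) k :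
  (c *: M) ^+ k = c ^+ k *: M ^+ k.
Proof.
elim: k => [|k IHk]; first by rewrite !expr0 scale1r.
by rewrite !exprS IHk -[LHS]scalemxAl -scalemxAr scalerA.
Qed.

Lemma mulmxZ2 (C : comPzRingType) m (c : C) (M N : 'M[C]_m) :
  (c *: M) *m (c *: N) = c ^+ 2 *: (M *m N).
Proof. by rewrite -scalemxAl -scalemxAr scalerA. Qed.

Lemma mulmxZ3 (C : comPzRingType) m (c : C) (M N P : 'M[C]_m) :
  (c *: M) *m (c *: N) *m (c *: P) = c ^+ 3 *: (M *m N *m P).
Proof. by rewrite mulmxZ2 -scalemxAl -scalemxAr scalerA -exprSr. Qed.

Lemma unitarymxZ (C : numClosedFieldType) m (c : C) (M : 'M[C]_m) :
  `|c| = 1 -> M \is unitarymx -> c *: M \is unitarymx.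
Proof.
move=> c1 /unitarymxP MM; apply/unitarymxP.
rewrite linearZ /= map_mxZ /= -scalemxAl -scalemxAr MM scalerA.
by rewrite -normCK c1 expr1n scale1r.
Qed.

(** The image lies in the finite set of Clifford operators; the finite order of the generators puts
    their inverses there as well. *)
Lemma finite_braid_rep (C : numClosedFieldType) (A : finZmodType)
    (b : A -> A -> C) n K (R : 'M[C]_(#|A| * #|A|)) :
    symmetric_bicharacter b -> Defs.nondegenerate b -> (0 < K)%N ->
    (forall i : 'I_n.-1, [/\ local_op R i \is unitarymx, local_op R i ^+ K = 1
       & clifford (prod_bichar b) (@digits A n) K (local_op R i)]) ->
    (forall i j : 'I_n.-1, (i.+1 < j)%N ->
       local_op R i *m local_op R j = local_op R j *m local_op R i) ->
    (forall i j : 'I_n.-1, j = i.+1 :> nat ->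
       local_op R i *m local_op R j *m local_op R i =
       local_op R j *m local_op R i *m local_op R j) ->
  exists2 rho : {multiplicative braid_group n -> unitary_group C (#|A| ^ n)},
    is_braid_rep R rho & finite_set (range rho).
Proof.
move=> bP b_nd K_gt0 RP far near.
have BP := prod_bicharP n bP; have B_nd := prod_bichar_nd (n := n) bP b_nd.
have [h gK hK] := digits_bij A n.
have [|||||rho rhoP rho_cliff] := @braid_rep_exists _ _ _ R _ far near
    (clifford (prod_bichar b) (@digits A n) K).
- by move=> i; case: (RP i).
- exact: clifford1.
- by move=> M N; exact: cliffordM.
- by move=> i; case: (RP i).
- by move=> i; case: (RP i) => R_unitary RK; exact: clifford_adj.
exists rho => //.
apply: (@sub_finite_set _ _
    (@unitary_val _ _ @^-1` clifford (prod_bichar b) (@digits A n) K)).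
  by move=> _ [x _ <-]; exact: rho_cliff.
apply: finite_preimage; last exact: (finite_clifford BP gK hK B_nd).
by move=> M N _ _; exact: val_inj.
Qed.

(** * Relative positions of the active strands *)

Section Strands.
Variable n : nat.
Implicit Types i j : 'I_n.-1.

Lemma strand_lr i :
  ((strandl i == strandr i) = false) * ((strandr i == strandl i) = false).
Proof.
by split; apply/eqP => /(congr1 val); have := strand_succ i => /=; lia.
Qed.

Lemma strandl_succ i j : j = i.+1 :> nat -> strandl j = strandr i.
Proof. by move=> ij; apply: val_inj; rewrite /= ij. Qed.

Lemma strand_far i j : (i < j)%N ->
  ((strandl i == strandr j) = false) * ((strandr j == strandl i) = false) *
  ((strandr i == strandr j) = false) * ((strandr j == strandr i) = false) *
  ((strandl i == strandl j) = false) * ((strandl j == strandl i) = false).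
Proof.
have := ltn_ord i; have := ltn_ord j => jn lin ij.
by do !split; apply/eqP => /(congr1 val) /=; lia.
Qed.

Lemma strand_far2 i j : (i.+1 < j)%N ->
  ((strandr i == strandl j) = false) * ((strandl j == strandr i) = false).
Proof.
have := ltn_ord i; have := ltn_ord j => jn lin ij.
by split; apply/eqP => /(congr1 val) /=; lia.
Qed.

End Strands.

(** * The two families of operators *)

Section Parts.
Variables (C : numClosedFieldType) (A : finZmodType) (q : A -> C) (n : nat).
Hypothesis hq : metric_group q.
Local Notation b := (pairing q).
Local Notation K := (#|A| * (4 * (#|A| * 2)))%N.

Let bP : symmetric_bicharacter b.
Proof. by case: hq. Qed.

Let b_nd : Defs.nondegenerate b.
Proof. by case: hq. Qed.

Let K_gt0 : (0 < K)%N.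
Proof. by rewrite !muln_gt0 finzmod_gt0. Qed.

Let BP := prod_bicharP n bP.

Let B_exp (x y : {ffun 'I_n -> A}) : prod_bichar b x y ^+ #|A| = 1.
Proof. exact: prod_bichar_exp. Qed.

Let bDl := bicharDl bP.
Let bNl := bicharNl bP.
Let bNr := bicharNr bP.

Let BDl := bicharDl BP.

Local Notation weyl_op u w := (weyl_rep (prod_bichar b) (@digits A n) u w).

Lemma local_op_gaussian Q i : local_op (R_gaussian q Q) i =
  gauss_op (weyl_op (single (strandl i)) (single (strandr i))) Q.
Proof.
rewrite local_opZ local_op_sum; congr (_ *: _); apply: eq_bigr => a _.
rewrite local_opZ; congr (_ *: _).
have phase0 : phase_mx q 0 = 1%:M.
  by apply/matrixP => x y; rewrite !mxE (bichar0l bP).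
have shift0 : shift_mx C (0 : A) = 1%:M.
  by apply/matrixP => x y; rewrite !mxE addr0 (inj_eq enum_val_inj).
have -> : shift_mx C a *t phase_mx q a =
    (shift_mx C a *m phase_mx q 0) *t (shift_mx C 0 *m phase_mx q a).
  by rewrite phase0 shift0 mulmx1 mul1mx.
by rewrite local_op_weyl // !single0 addr0 add0r.
Qed.

Lemma finite_gaussian_rep Q : Qminus q Q ->
  exists2 rho : {multiplicative braid_group n -> unitary_group C (#|A| ^ n)},
    is_braid_rep (R_gaussian q Q) rho & finite_set (range rho).
Proof.
case=> chi [chi_norm chiD] QE; have [q_norm _ _ _] := hq.
have [h gK hK] := digits_bij A n.
(* [Q] is an inverse of [q] times a character, hence quadratic for the inverse pairing, obtained as
   the twist by negation. *)
pose b' x y := b (- x) y.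
have oppD : {morph -%R : x y / x + y :> A} by move=> x y; rewrite opprD.
have b'P : symmetric_bicharacter b'.
  by apply: (twist_bichar bP oppD) => x y; rewrite bNl bNr.
have b'_nd : Defs.nondegenerate b'.
  by apply: (twist_nd b_nd oppD); exact: oppr_inj.
have q_neq0 x : q x != 0 by rewrite -normr_eq0 q_norm oner_eq0.
have QP : quadratic_for b' Q.
  split=> [x|x y].
    by rewrite QE normrM normfV q_norm chi_norm invr1 mulr1.
  by rewrite !QE chiD /b' bNl /pairing; field; rewrite !q_neq0.
have wu1 (i : 'I_n.-1) a c :
    prod_bichar b (single (strandr i) a) (single (strandl i) c) = 1.
  by rewrite prod_bichar_single // ffunE strand_lr (bichar0r bP).
apply: (finite_braid_rep bP b_nd K_gt0) => [i|i j ij|i j ij].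
- rewrite local_op_gaussian; split.
  + exact: (weyl_gauss_unitary BP gK hK
      (singleD _) (singleD _) (wu1 i) b'P QP b'_nd).
  + exact: (weyl_gauss_exp BP gK hK
      (singleD _) (singleD _) (wu1 i) b'P QP b'_nd).
  apply: (weyl_gauss_clifford BP gK hK
      (singleD _) (singleD _) (wu1 i) b'P QP b'_nd B_exp).
  (* The character to match is [b (x (strandr i) - y (strandl i))]; the sign flips because [b']
     inverts the pairing. *)
  move=> x y; exists (y (strandl i) - x (strandr i)) => a.
  rewrite prod_bichar_single // (bicharC BP y) prod_bichar_single //.
  by rewrite /b' opprB bDl bNl !(bicharC bP a).
- rewrite !local_op_gaussian; apply: gauss_op_commute2 => a c.
  rewrite -[RHS]scale1r; apply: (weyl_rep_swap BP gK hK).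
  rewrite !prod_bichar_single // !ffunE.
  rewrite (strand_far2 ij) !(strand_far (ltnW ij)).
  by rewrite !(bichar0r bP) mulr1.
rewrite !local_op_gaussian.
have ij' : (i < j)%N by rewrite ij.
apply: (gauss_op_YB b'P QP).
- exact: (weyl_repP BP gK hK (singleD _) (singleD _) (wu1 i)).
- exact: (weyl_repP BP gK hK (singleD _) (singleD _) (wu1 j)).
(* Only the shared strand matters: there the first generator acts by a phase and the second by a
   shift. *)
move=> a c; apply: (weyl_rep_swap BP gK hK).
rewrite !prod_bichar_single // !ffunE !(strand_far ij') (strandl_succ ij) eqxx.
by rewrite (bichar0r bP) /b' bNl (bicharC bP c) mulVf ?(bichar_neq0 bP).
Qed.

(** [hop] labels X_t (x) X_{-t} and [tot] labels Z_t (x) Z_t. On the same pair of strands these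
    commute, since hopping preserves the total label. *)
Let hop (l r : 'I_n) (t : A) : {ffun 'I_n -> A} := single l t + single r (- t).
Let tot (l r : 'I_n) (t : A) : {ffun 'I_n -> A} := single l t + single r t.
Let zero (t : A) : {ffun 'I_n -> A} := 0.

(** The double sum factors because a pure shift times a pure phase operator is a Weyl operator
    without extra phase; the factor 1/|A| splits into two normalisations. *)
Lemma local_op_automorphism QE PE i : local_op (R_automorphism q QE PE) i =
  (gauss_sum PE)^* *:
    (gauss_op (weyl_op (hop (strandl i) (strandr i)) zero) QE *m
     gauss_op (weyl_op zero (tot (strandl i) (strandr i))) PE).
Proof.
have [h gK hK] := digits_bij A n.
rewrite local_opZ -scalerA; congr (_ *: _); rewrite local_op_sum.
rewrite gauss_op_mulr -sqrt_cardV2 -scalerA; congr (_ *: _).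
rewrite scaler_sumr; apply: eq_bigr => t _; rewrite local_op_sum.
rewrite gauss_op_mull scalerA mulrC -scalerA; congr (_ *: _).
rewrite scaler_sumr; apply: eq_bigr => c _; rewrite local_opZ -scalerA.
congr (_ *: (_ *: _)); rewrite local_op_weyl // (weylM BP gK hK).
by rewrite (bichar0l BP) scale1r addr0 add0r.
Qed.

Lemma finite_automorphism_rep (E F : A -> A) QE PE :
    cancel E F -> cancel F E -> {morph E : x y / x + y} ->
    (forall x y, b (E x) y = b x (E y)) ->
    quadratic_for (fun x y => b (E x) y) QE ->
    quadratic_for (fun x y => b (F x) y) PE ->
  exists2 rho : {multiplicative braid_group n -> unitary_group C (#|A| ^ n)},
    is_braid_rep (R_automorphism q QE PE) rho & finite_set (range rho).
Proof.
move=> EK FK ED E_adj QP PP; have [h gK hK] := digits_bij A n.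
have FD : {morph F : x y / x + y}.
  by move=> x y; apply: (can_inj EK); rewrite ED !FK.
have F_adj x y : b (F x) y = b x (F y) by rewrite -{1}(FK y) -E_adj FK.
have bEP := twist_bichar bP ED E_adj; have bFP := twist_bichar bP FD F_adj.
have bE_nd := twist_nd b_nd ED (can_inj EK).
have bF_nd := twist_nd b_nd FD (can_inj FK).
have hopD l r : {morph hop l r : x y / x + y}.
  by move=> x y; rewrite /hop opprD !singleD addrACA.
have totD l r : {morph tot l r : x y / x + y}.
  by move=> x y; rewrite /tot !singleD addrACA.
have zeroD : {morph zero : x y / x + y} by move=> x y; rewrite /zero addr0.
have wuT l r a c : prod_bichar b (zero a) (hop l r c) = 1.
  by rewrite (bichar0l BP).
have wuS l r a c : prod_bichar b (tot l r a) (zero c) = 1.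
  by rewrite (bichar0r BP).
(* A root of unity: it preserves unitarity, the order bound and the Clifford property, and it enters
   both sides of each braid relation to the same power. *)
set kappa := (gauss_sum PE)^*.
have kappaK : kappa ^+ K = 1.
  by rewrite -rmorphXn /= (gauss_sum_exp bFP bF_nd PP) rmorph1.
have kappa1 : `|kappa| = 1 by rewrite norm_conjC (gauss_sum_norm bFP bF_nd PP).
pose T i := weyl_op (hop (strandl i) (strandr i)) zero.
pose S i := weyl_op zero (tot (strandl i) (strandr i)).
pose U i := gauss_op (T i) QE; pose W i := gauss_op (S i) PE.
have opE i : local_op (R_automorphism q QE PE) i = kappa *: (U i *m W i).
  exact: local_op_automorphism.
have TS i a c : T i a *m S i c = S i c *m T i a.
  rewrite -[RHS]scale1r; apply: (weyl_rep_swap BP gK hK).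
  rewrite (bichar0l BP) BDl !prod_bichar_single // !ffunE !eqxx !strand_lr.
  by rewrite addr0 add0r bNr mulfV ?mulr1 ?(bichar_neq0 bP).
have TT i j a c : T i a *m T j c = T j c *m T i a.
  rewrite -[RHS]scale1r; apply: (weyl_rep_swap BP gK hK).
  by rewrite !(bichar0l BP) mulr1.
have SS i j a c : S i a *m S j c = S j c *m S i a.
  rewrite -[RHS]scale1r; apply: (weyl_rep_swap BP gK hK).
  by rewrite !(bichar0r BP) mulr1.
apply: (finite_braid_rep bP b_nd K_gt0) => [i|i j ij|i j ij].
- have U_unit : U i \is unitarymx.
    exact: (weyl_gauss_unitary BP gK hK
      (hopD _ _) zeroD (wuT _ _) bEP QP bE_nd).
  have W_unit : W i \is unitarymx.
    exact: (weyl_gauss_unitary BP gK hK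
      zeroD (totD _ _) (wuS _ _) bFP PP bF_nd).
  have UK : U i ^+ K = 1.
    exact: (weyl_gauss_exp BP gK hK
      (hopD _ _) zeroD (wuT _ _) bEP QP bE_nd).
  have WK : W i ^+ K = 1.
    exact: (weyl_gauss_exp BP gK hK
      zeroD (totD _ _) (wuS _ _) bFP PP bF_nd).
  rewrite opE; split.
  + by apply: unitarymxZ => //; exact: mul_unitarymx.
  + have UW : U i *m W i = W i *m U i by exact: gauss_op_commute2.
    by rewrite exprZmx kappaK scale1r exprMn_comm // UK WK mulr1.
  apply: cliffordZ => //; apply: cliffordM.
  + apply: (weyl_gauss_clifford BP gK hK
      (hopD _ _) zeroD (wuT _ _) bEP QP bE_nd B_exp).
    (* The hop on strands [i] produces the character of [y (strandr i) - y (strandl i)]; [F]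
       compensates the twist by [E]. *)
    move=> x y; exists (F (y (strandr i) - y (strandl i))) => a.
    rewrite (bichar0l BP) mul1r FK (bicharC BP) BDl !prod_bichar_single //.
    by rewrite bNl bDl bNl invfM invrK !(bicharC bP a) mulrC.
  + apply: (weyl_gauss_clifford BP gK hK
      zeroD (totD _ _) (wuS _ _) bFP PP bF_nd B_exp).
    (* Here the character is that of the total of [x] on both strands, and [E] compensates the twist
       by [F]. *)
    move=> x y; exists (E (x (strandl i) + x (strandr i))) => a.
    rewrite (bichar0r BP) divr1 EK BDl !prod_bichar_single //.
    by rewrite bDl !(bicharC bP a).
- rewrite !opE [LHS]mulmxZ2 [RHS]mulmxZ2; congr (_ *: _).
  have TSij (k l : 'I_n.-1) a c : (k.+1 < l)%N \/ (l.+1 < k)%N ->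
      T k a *m S l c = S l c *m T k a.
    move=> kl; rewrite -[RHS]scale1r; apply: (weyl_rep_swap BP gK hK).
    rewrite (bichar0l BP) BDl !prod_bichar_single // !ffunE.
    case: kl => kl; rewrite !(strand_far2 kl) !(strand_far (ltnW kl)) /=;
      by rewrite addr0 !(bichar0r bP) !mulr1.
  have UU : U i *m U j = U j *m U i by exact: gauss_op_commute2.
  have WW : W i *m W j = W j *m W i by exact: gauss_op_commute2.
  have UW : U i *m W j = W j *m U i.
    by apply: gauss_op_commute2 => a c; apply: TSij; left.
  have WU : W i *m U j = U j *m W i.
    by apply/esym/gauss_op_commute2 => a c; apply: TSij; right.
  suff : GRing.comm (U i * W i) (U j * W j) by [].
  by apply: commrM; apply/commr_sym/commrM; apply: commr_sym.
rewrite !opE [LHS]mulmxZ3 [RHS]mulmxZ3; congr (_ *: _).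
have ij' : (i < j)%N by rewrite ij.
have TP k := weyl_repP BP gK hK (hopD (strandl k) (strandr k)) zeroD (wuT _ _).
have SP k := weyl_repP BP gK hK zeroD (totD (strandl k) (strandr k)) (wuS _ _).
(* The shared strand is the right end of the first hop, with label [- a], and the left end of the
   second, with label [c]; this sign makes both mixed commutation phases equal to [b a c]. *)
apply: (gauss_op2_YB bP EK FK ED bEP bFP QP PP (TP i) (TP j) (SP i) (SP j)
  (TT i j) (SS i j) (TS i) (TS j)) => a c;
  apply: (weyl_rep_swap BP gK hK).
- rewrite (bichar0l BP) BDl !prod_bichar_single // !ffunE !(strand_far ij').
  rewrite (strandl_succ ij) !eqxx !addr0 sub0r (bichar0r bP) mulr1 bNr.
  by rewrite (bicharC bP c) mulfV ?(bichar_neq0 bP).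
rewrite (bichar0l BP) BDl !prod_bichar_single // !ffunE !(strand_far ij').
by rewrite (strandl_succ ij) !eqxx !addr0 (bichar0r bP) mul1r mulr1.
Qed.

End Parts.

(** * Both families over the complex numbers *)

Theorem corollary8p5 (R : realType) (A : finZmodType) (q : A -> R[i]) (n : nat)
    (hq : metric_group q) (hn : (2 <= n)%N) :
  (forall Q : A -> R[i], Qminus q Q ->
    exists2 rho : {multiplicative braid_group n -> unitary_group R[i] (#|A| ^ n)},
      is_braid_rep (R_gaussian q Q) rho & finite_set (range rho)) /\
  (forall (E : {perm A}) (QE PE : A -> R[i]),
    {morph E : x y / x + y} ->
    (forall x y, pairing q (E x) y = pairing q x (E y)) ->
    U1_valued QE ->
    U1_valued PE ->
    (forall x y, QE (x + y) = QE x * QE y * pairing q (E x) y) ->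
    (forall x y, PE (x + y) = PE x * PE y * pairing q ((E^-1)%g x) y) ->
    exists2 rho : {multiplicative braid_group n -> unitary_group R[i] (#|A| ^ n)},
      is_braid_rep (R_automorphism q QE PE) rho & finite_set (range rho)).
Proof.
split=> [Q|E QE PE ED E_adj QE1 PE1 QED PED]; first exact: finite_gaussian_rep.
exact: (@finite_automorphism_rep _ _ _ n hq _ _ _ _ (permK E) (permKV E)
  ED E_adj (conj QE1 QED) (conj PE1 PED)).
Qed.
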